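(* Let $G$ be a graph on $n$ vertices and let $w\in\mathbb{R}^n_+$ be a vector with nonnegative entries, indexed by $V(G)$. For a cone $\mathcal{K}$ of real symmetric $n\times n$ matrices consider the program $$\max\ \big\langle \sqrt{w}\sqrt{w}^{\,T},Z\big\rangle\quad\text{subject to}\quad \big\langle (I+\overline{A})_w,Z\big\rangle=1,\quad Z\in\mathcal{K}.$$ If $\mathcal{K}$ is the doubly nonnegative cone, this program is equal to $\chi_{\mathrm{vec}}(G;w)$; and if $\mathcal{K}=\mathcal{CP}_n$, this program is equal to $\omega(G;w)$.
   Context: Graphs are finite and simple. $I$ is the identity matrix and $\overline{A}$ is the adjacency matrix of the complement of $G$; $\langle M,N\rangle=\mathrm{tr}(MN)$ for real symmetric matrices; $\circ$ is the entrywise product; $\sqrt{w}$ is the entrywise square root of $w$. A real symmetric matrix is doubly nonnegative if it is positive semidefinite and entrywise nonnegative. $\mathcal{CP}_n=\{\sum_{i=1}^k x_ix_i^T: x_i\in\mathbb{R}^n,\ x_i\ge 0\}$ is the cone of completely positive matrices. $D(u)$ is the diagonal matrix with diagonal $u$, $D(u)^+$ is its pseudo-inverse, and for symmetric $M$, $$M_w=\tfrac12\Big(D(\sqrt w)\,M\,D(\sqrt w)^{+}+D(\sqrt w)^{+}\,M\,D(\sqrt w)\Big).$$ The vertex-weighted parameters $\chi_{\mathrm{vec}}(G;w)$ (weighted vector chromatic number) and $\omega(G;w)$ (weighted clique number) are given by the program: maximize $\langle \sqrt{w}\sqrt{w}^{\,T},Z\rangle$ subject to $\langle I,Z\rangle=1$,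 $Z\circ\overline{A}=0$, $Z\in\mathcal{K}$. Its value is $\chi_{\mathrm{vec}}(G;w)$ when $\mathcal{K}$ is the doubly nonnegative cone, and $\omega(G;w)$ when $\mathcal{K}=\mathcal{CP}_n$. *)

(* Defs.v *)
From HB Require Import structures.
From mathcomp Require Import all_boot all_order all_algebra.
From mathcomp Require Import boolp classical_sets reals.

Set Implicit Arguments.
Unset Strict Implicit.
Unset Printing Implicit Defensive.

Import Order.TTheory GRing.Theory Num.Theory.

Local Open Scope classical_set_scope.
Local Open Scope ring_scope.

(* A graph on n vertices is a symmetric irreflexive relation on 'I_n; these two
   properties are hypotheses of the theorem, not part of the definitions below. *)

Definition inner (R : realType) (n : nat) (M N : 'M[R]_n) : R := \tr (M *m N).

Definition compl_adj (R : realType) (n : nat) (G : rel 'I_n) : 'M[R]_n :=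
  \matrix_(i, j) ((i != j) && ~~ G i j)%:R.

Definition psd (R : realType) (n : nat) : set 'M[R]_n :=
  [set Z | Z^T = Z /\ forall x : 'cV[R]_n, 0 <= (x^T *m Z *m x) 0 0].

Definition DNN (R : realType) (n : nat) : set 'M[R]_n :=
  [set Z | psd Z /\ forall i j, 0 <= Z i j].

Definition CP (R : realType) (n : nat) : set 'M[R]_n :=
  [set Z | exists k, exists x : 'I_k -> 'cV[R]_n,
     (forall l i, 0 <= x l i 0) /\ Z = \sum_l x l *m (x l)^T].

Definition sqrtv (R : realType) (n : nat) (w : 'cV[R]_n) : 'cV[R]_n :=
  map_mx Num.sqrt w.

Definition Dg (R : realType) (n : nat) (u : 'cV[R]_n) : 'M[R]_n := diag_mx u^T.

(* The four Penrose equations, which characterize the pseudo-inverse B of A. *)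
Definition is_pinv (R : realType) (n : nat) (A B : 'M[R]_n) : Prop :=
  [/\ A *m B *m A = A, B *m A *m B = B,
      (A *m B)^T = A *m B & (B *m A)^T = B *m A].

(* Since 0^-1 = 0, zero diagonal entries stay zero, so that this is the
   pseudo-inverse of Dg u for every u (Dg_pinvP, is_pinv_inj). *)
Definition Dg_pinv (R : realType) (n : nat) (u : 'cV[R]_n) : 'M[R]_n :=
  Dg (map_mx (fun a : R => a^-1) u).

Lemma Dg_pinvP (R : realType) (n : nat) (u : 'cV[R]_n) :
  is_pinv (Dg u) (Dg_pinv u).
Proof.
have key (a : R) : a * a^-1 * a = a.
  by have [->|a0] := eqVneq a 0; [rewrite mulr0 | rewrite divff ?mul1r].
rewrite /is_pinv /Dg_pinv /Dg !mulmx_diag !tr_diag_mx; split=> //; congr diag_mx;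
  apply/rowP => i; rewrite !mxE ?key //.
by rewrite -{2}(invrK (u i 0)) key.
Qed.

Lemma is_pinv_inj (R : realType) (n : nat) (A B C : 'M[R]_n) :
  is_pinv A B -> is_pinv A C -> B = C.
Proof.
move=> [b1 b2 b3 b4] [c1 c2 c3 c4].
have AB_AC : A *m B = A *m C.
  rewrite -[LHS]b3 -{1}c1 -[A *m C *m A *m B]mulmxA trmx_mul b3 c3.
  by rewrite !mulmxA b1.
have BA_CA : B *m A = C *m A.
  rewrite -[LHS]b4 -{1}c1 -[A *m C *m A]mulmxA mulmxA trmx_mul b4 c4.
  by rewrite -[LHS]mulmxA [A *m (B *m A)]mulmxA b1.
by rewrite -b2 BA_CA -mulmxA AB_AC mulmxA c2.
Qed.

(* The entry (i, j) is M i j * (a / b + b / a) / 2 with a = sqrt w_i and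
   b = sqrt w_j; it vanishes as soon as w_i or w_j is 0. *)
Definition wmx (R : realType) (n : nat) (w : 'cV[R]_n) (M : 'M[R]_n) : 'M[R]_n :=
  2^-1 *: (Dg (sqrtv w) *m M *m Dg_pinv (sqrtv w)
           + Dg_pinv (sqrtv w) *m M *m Dg (sqrtv w)).

Definition objective (R : realType) (n : nat) (w : 'cV[R]_n) (Z : 'M[R]_n) : R :=
  inner (sqrtv w *m (sqrtv w)^T) Z.

(* On an empty feasible set sup is 0: an infeasible program has value 0, the
   least value that the objective can take on a nonnegative matrix. *)
Definition opt_value (R : realType) (n : nat) (w : 'cV[R]_n)
    (F : set 'M[R]_n) : R :=
  sup (objective w @` F).

Definition attained (R : realType) (n : nat) (w : 'cV[R]_n)
    (F : set 'M[R]_n) : Prop :=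
  exists2 Z, F Z & forall Y, F Y -> objective w Y <= objective w Z.

Definition std_feasible (R : realType) (n : nat) (G : rel 'I_n)
    (K : set 'M[R]_n) : set 'M[R]_n :=
  [set Z | [/\ inner 1%:M Z = 1, map2_mx *%R Z (compl_adj R G) = 0 & K Z]].

Definition chi_vec (R : realType) (n : nat) (G : rel 'I_n) (w : 'cV[R]_n) : R :=
  opt_value w (std_feasible G (@DNN R n)).

Definition omega (R : realType) (n : nat) (G : rel 'I_n) (w : 'cV[R]_n) : R :=
  opt_value w (std_feasible G (@CP R n)).

Definition wgt_feasible (R : realType) (n : nat) (G : rel 'I_n) (w : 'cV[R]_n)
    (K : set 'M[R]_n) : set 'M[R]_n :=
  [set Z | inner (wmx w (1%:M + compl_adj R G)) Z = 1 /\ K Z].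

(* Main.v *)
Require Import Defs.
From mathcomp Require Import all_boot all_order all_algebra.
From mathcomp Require Import boolp classical_sets reals.
From mathcomp Require Import topology normedtype derive.
From mathcomp Require Import ring lra.
(* Write a = sqrt w.  The constraint of the weighted program reads
   sum_(i, j not adjacent) (a_j / a_i) Z_ij = 1, where i = j is allowed; on a
   matrix satisfying Z o Abar = 0 it is the trace over the support of w.
   - Doubly nonnegative cone: the off-diagonal entries of a matrix at
     nonadjacent pairs can be moved to the diagonal by adding rank-one positive
     semidefinite matrices orthogonal to a; this preserves the objective and
     turns the weighted constraint into the trace constraint.  The converse is
     a rescaling, and the maximum is attained in the standard program, whose
     feasible set is compact.
   - Completely positive cone: on a rank-one matrix x x^T the inequality
     (a^T x)^2 <= lam * <(I + Abar)_w, x x^T>, with lam the largest weight of a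
     clique, is a weighted Motzkin-Straus theorem.  A rank-one matrix supported
     on a heaviest clique is feasible and optimal in both programs. *)

Set Implicit Arguments.
Unset Strict Implicit.
Unset Printing Implicit Defensive.

Import Order.TTheory GRing.Theory Num.Theory.
Import numFieldNormedType.Exports.
Local Open Scope ring_scope.

(** * Entrywise formulas for the inner product, the objective and the weighted matrix *)

Lemma innerE (R : realType) (n : nat) (M N : 'M[R]_n) :
  inner M N = \sum_i \sum_j M i j * N j i.
Proof. by apply: eq_bigr => i _; rewrite mxE. Qed.

Lemma innerZr (R : realType) (n : nat) (M N : 'M[R]_n) (c : R) :
  inner M (c *: N) = c * inner M N.
Proof. by rewrite /inner -scalemxAr mxtraceZ. Qed.

Lemma quadE (R : realType) (n : nat) (x : 'cV[R]_n) (Z : 'M[R]_n) :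
  (x^T *m Z *m x) 0 0 = \sum_i \sum_j x i 0 * Z i j * x j 0.
Proof.
rewrite mxE exchange_big; apply: eq_bigr => j _; rewrite mxE big_distrl.
by apply: eq_bigr => i _; rewrite mxE.
Qed.

Lemma inner_rank1 (R : realType) (n : nat) (x : 'cV[R]_n) (M : 'M[R]_n) :
  inner (x *m x^T) M = (x^T *m M *m x) 0 0.
Proof. by rewrite /inner -mulmxA mxtrace_mulC /mxtrace big_ord1. Qed.

Lemma objectiveE (R : realType) (n : nat) (w : 'cV[R]_n) (Z : 'M[R]_n) :
  objective w Z = \sum_i \sum_j sqrtv w i 0 * Z i j * sqrtv w j 0.
Proof. by rewrite /objective inner_rank1 quadE. Qed.

Lemma objectiveZ (R : realType) (n : nat) (w : 'cV[R]_n) (Z : 'M[R]_n) (c : R) :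
  objective w (c *: Z) = c * objective w Z.
Proof. exact: innerZr. Qed.

Lemma add1_compl_adjE (R : realType) (n : nat) (G : rel 'I_n) :
  irreflexive G ->
  1%:M + compl_adj R G = \matrix_(i, j) (~~ G i j)%:R.
Proof.
move=> irrG; apply/matrixP => i j; rewrite !mxE.
by have [->|_] := eqVneq i j; rewrite ?irrG ?addr0 ?add0r.
Qed.

Lemma wmxE (R : realType) (n : nat) (w : 'cV[R]_n) (M : 'M[R]_n) i j :
  wmx w M i j = 2^-1 * M i j * (sqrtv w i 0 / sqrtv w j 0
                                + sqrtv w j 0 / sqrtv w i 0).
Proof.
rewrite mxE [X in _ * X]mxE /Dg_pinv /Dg !mul_diag_mx !mul_mx_diag !mxE.
by ring.
Qed.

(** Swapping the indices exchanges the two halves of [wmx], so on a symmetric matrix they contribute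
    equally and one ratio suffices. *)
Lemma inner_wmxE (R : realType) (n : nat) (G : rel 'I_n) (w : 'cV[R]_n)
    (Z : 'M[R]_n) :
  symmetric G -> irreflexive G -> Z^T = Z ->
  inner (wmx w (1%:M + compl_adj R G)) Z =
  \sum_i \sum_j (~~ G i j)%:R * (sqrtv w j 0 / sqrtv w i 0) * Z i j.
Proof.
move=> symG irrG symZ; rewrite innerE add1_compl_adjE //.
have symZE i j : Z j i = Z i j by rewrite -{1}symZ mxE.
set S := RHS.
have S_swap : S =
    \sum_i \sum_j (~~ G i j)%:R * (sqrtv w i 0 / sqrtv w j 0) * Z i j.
  rewrite /S exchange_big; apply: eq_bigr => i _; apply: eq_bigr => j _.
  by rewrite symG symZE.
have -> : S = 2^-1 * (S + S) by lra.
rewrite {1}S_swap /S -big_split mulr_sumr; apply: eq_bigr => i _.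
rewrite -big_split mulr_sumr; apply: eq_bigr => j _ /=.
by rewrite wmxE mxE symZE; ring.
Qed.

(** * Positive semidefinite, doubly nonnegative and completely positive matrices *)

Lemma psd_offdiag_le (R : realType) (n : nat) (Z : 'M[R]_n) i j :
  psd Z -> Z i j *+ 2 <= Z i i + Z j j.
Proof.
(* The quadratic form is tested on e_i - e_j. *)
move=> [symZ /(_ (delta_mx i 0 - delta_mx j 0))].
have -> : (delta_mx i 0 - delta_mx j 0 : 'cV[R]_n)^T =
          delta_mx 0 i - delta_mx 0 j.
  by rewrite linearB /= !trmx_delta.
rewrite mulmxBl !mulmxBr -!rowE -!colE !mxE.
have -> : Z j i = Z i j by rewrite -{1}symZ mxE.
by rewrite mulr2n; lra.
Qed.

Lemma psdZ (R : realType) (n : nat) (Z : 'M[R]_n) (c : R) :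
  0 <= c -> psd Z -> psd (c *: Z).
Proof.
move=> c_ge0 [symZ Z_ge0]; split=> [|x]; first by rewrite linearZ /= symZ.
by rewrite -scalemxAr -scalemxAl mxE mulr_ge0.
Qed.

Lemma DNNZ (R : realType) (n : nat) (Z : 'M[R]_n) (c : R) :
  0 <= c -> DNN Z -> DNN (c *: Z).
Proof.
move=> c_ge0 [psdZ0 Z_ge0]; split=> [|i j]; first exact: psdZ.
by rewrite mxE mulr_ge0.
Qed.

Lemma CP_subset_DNN (R : realType) (n : nat) (Z : 'M[R]_n) : CP Z -> DNN Z.
Proof.
move=> [k [x [x_ge0 ->]]]; split; first split.
- rewrite linear_sum; apply: eq_bigr => l _ /=.
  by rewrite trmx_mul trmxK.
- move=> y; rewrite mulmx_sumr mulmx_suml summxE sumr_ge0 // => l _.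
  rewrite mulmxA -mulmxA mxE big_ord1.
  have -> : ((x l)^T *m y) 0 0 = (y^T *m x l) 0 0.
    by rewrite -[in RHS](trmxK (x l)) -trmx_mul [RHS]mxE.
  by rewrite -expr2 sqr_ge0.
- move=> i j; rewrite summxE sumr_ge0 // => l _.
  by rewrite mxE big_ord1 mxE mulr_ge0.
Qed.

(** * Feasible matrices of the standard program *)

Lemma std_feasible_offdiag (R : realType) (n : nat) (G : rel 'I_n)
    (K : set 'M[R]_n) (Z : 'M[R]_n) i j :
  std_feasible G K Z -> i != j -> ~~ G i j -> Z i j = 0.
Proof.
move=> [_ /matrixP/(_ i j)]; rewrite !mxE => + _ neq_ij nGij.
by rewrite neq_ij nGij mulr1.
Qed.

Lemma std_feasible_trace (R : realType) (n : nat) (G : rel 'I_n)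
    (K : set 'M[R]_n) (Z : 'M[R]_n) :
  std_feasible G K Z -> \sum_i Z i i = 1.
Proof. by move=> [<- _ _]; rewrite /inner mul1mx. Qed.

Lemma std_feasible_wmxE (R : realType) (n : nat) (G : rel 'I_n) (w : 'cV[R]_n)
    (K : set 'M[R]_n) (Z : 'M[R]_n) :
  symmetric G -> irreflexive G -> Z^T = Z -> std_feasible G K Z ->
  inner (wmx w (1%:M + compl_adj R G)) Z =
  \sum_i (sqrtv w i 0 / sqrtv w i 0) * Z i i.
Proof.
move=> symG irrG symZ stdZ; rewrite inner_wmxE //; apply: eq_bigr => i _.
rewrite (bigD1 i) //= irrG mul1r big1 ?addr0 // => j neq_ji.
have [|nGij] := boolP (G i j); first by rewrite !mul0r.
by rewrite (std_feasible_offdiag stdZ) 1?eq_sym ?mulr0.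
Qed.

(** The ratios in [std_feasible_wmxE] are 1 on the support of [w] and 0 off it, since [0^-1 = 0];
    the value is thus a part of the trace. *)
Lemma std_feasible_wmx_le1 (R : realType) (n : nat) (G : rel 'I_n)
    (w : 'cV[R]_n) (K : set 'M[R]_n) (Z : 'M[R]_n) :
  symmetric G -> irreflexive G -> DNN Z -> std_feasible G K Z ->
  0 <= inner (wmx w (1%:M + compl_adj R G)) Z <= 1.
Proof.
move=> symG irrG [[symZ _] Z_ge0] stdZ; rewrite (@std_feasible_wmxE _ _ _ _ K) //.
have ratio i : 0 <= sqrtv w i 0 / sqrtv w i 0 <= 1.
  have [->|nz] := eqVneq (sqrtv w i 0) 0; first by rewrite mul0r lexx ler01.
  by rewrite divff // ler01 lexx.
rewrite sumr_ge0 => [/=|i _]; last by have /andP[? _] := ratio i; exact: mulr_ge0.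
rewrite -(std_feasible_trace stdZ); apply: ler_sum => i _.
by have /andP[_ ?] := ratio i; rewrite ler_piMl.
Qed.

Lemma attained_opt_value (R : realType) (n : nat) (w : 'cV[R]_n)
    (F : set 'M[R]_n) (Z : 'M[R]_n) :
  F Z -> (forall Y, F Y -> objective w Y <= objective w Z) ->
  opt_value w F = objective w Z.
Proof.
move=> FZ maxZ; apply/le_anti/andP; split.
  by apply: ge_sup; [exists (objective w Z), Z | move=> _ [Y FY <-]; exact: maxZ].
by apply: ub_le_sup; [exists (objective w Z) => _ [Y FY <-]; exact: maxZ | exists Z].
Qed.


(** * Weighted Motzkin-Straus inequality *)

Lemma cauchy_schwarz_titu (R : realFieldType) (I : finType) (A : {set I})
    (y w : I -> R) :
  (forall i, i \in A -> 0 < w i) ->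
  (\sum_(i in A) y i) ^+ 2 <=
  (\sum_(i in A) w i) * \sum_(i in A) y i ^+ 2 / w i.
Proof.
move=> w_gt0; set s := \sum_(i in A) y i; set T := \sum_(i in A) w i.
have [A0|[i0 i0A]] := set_0Vmem A.
  by rewrite /s /T A0 !big_set0 expr0n mul0r.
have T_gt0 : 0 < T.
  rewrite /T (bigD1 i0) //= ltr_pwDl ?w_gt0 // sumr_ge0 // => i /andP[iA _].
  exact/ltW/w_gt0.
(* Equality holds for [y] proportional to [w], with factor s / T; expanding the squared deviations
   from that case gives the inequality. *)
have : 0 <= \sum_(i in A) (y i - s / T * w i) ^+ 2 / w i.
  by apply: sumr_ge0 => i iA; rewrite divr_ge0 ?sqr_ge0 // ltW ?w_gt0.
have -> : \sum_(i in A) (y i - s / T * w i) ^+ 2 / w i =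
          \sum_(i in A) y i ^+ 2 / w i - s ^+ 2 / T.
  transitivity (\sum_(i in A) (y i ^+ 2 / w i - (2 * (s / T)) * y i
                               + (s / T) ^+ 2 * w i)).
    apply: eq_bigr => i /w_gt0/lt0r_neq0 wi0; field.
    by rewrite wi0 lt0r_neq0.
  rewrite !big_split /= sumrN -!mulr_sumr -/s -/T.
  by field; rewrite lt0r_neq0.
by rewrite subr_ge0 ler_pdivrMr // mulrC.
Qed.

Definition clique (T : finType) (G : rel T) (C : {set T}) : bool :=
  [forall i in C, forall j in C, (i != j) ==> G i j].

Lemma cliqueP (T : finType) (G : rel T) (C : {set T}) :
  reflect (forall i j, i \in C -> j \in C -> i != j -> G i j) (clique G C).
Proof.
apply: (iffP forall_inP) => [clC i j iC jC|clC i iC].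
  by have /forall_inP/(_ j jC)/implyP := clC i iC.
by apply/forall_inP => j jC; apply/implyP; exact: clC.
Qed.

(* For i, j in the support and not adjacent, the quadratic form on the right is
   affine along the direction e_i - e_j, which preserves the sum: y is a convex
   combination of two vectors of smaller support, one lacking i, the other j. *)
Lemma motzkin_straus (R : realFieldType) (T : finType) (G : rel T)
    (w y : T -> R) (lam : R) :
  symmetric G -> irreflexive G ->
  (forall C : {set T}, clique G C -> \sum_(i in C) w i <= lam) ->
  (forall i, 0 <= y i) -> (forall i, y i != 0 -> 0 < w i) ->
  (\sum_i y i) ^+ 2 <=
  lam * \sum_i \sum_j (~~ G i j)%:R * (w i)^-1 * (y i * y j).
Proof.
(* Induction on a bound for the size of the support of [y]. *)
move=> symG irrG w_le; move: {2}#|_|.+1 (ltnSn #|[set i | y i != 0]|) => m.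
elim: m => // m IHm in y *; rewrite ltnS => card_y y_ge0 w_gt0.
pose q z := \sum_i \sum_j (~~ G i j)%:R * (w i)^-1 * (z i * z j).
have [clC|] := boolP (clique G [set i | y i != 0]).
  (* When the support is a clique only the terms with i = j survive, and Cauchy-Schwarz reduces the
     claim to w(C) <= lam. *)
  set C := [set i | y i != 0] in clC card_y.
  have sumC (F : T -> R) : (forall i, y i = 0 -> F i = 0) ->
      \sum_i F i = \sum_(i in C) F i.
    move=> F0; rewrite (bigID (mem C)) /= [X in _ + X]big1 ?addr0 // => i.
    by rewrite inE negbK => /eqP/F0.
  rewrite sumC // -/(q y).
  have -> : q y = \sum_(i in C) y i ^+ 2 / w i.
    rewrite /q sumC => [|i yi0]; last first.
      by rewrite big1 // => j _; rewrite yi0 mul0r mulr0.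
    apply: eq_bigr => i iC; rewrite (bigD1 i) //= irrG big1 ?addr0.
      by rewrite /=; ring.
    move=> j neq_ji; have [yj0|yj0] := eqVneq (y j) 0.
      by rewrite yj0 !mulr0.
    have -> : G i j by apply: (cliqueP _ _ clC); rewrite ?[j \in _]inE // eq_sym.
    by rewrite !mul0r.
  have w_gt0C i : i \in C -> 0 < w i by rewrite inE => /w_gt0.
  apply: (le_trans (cauchy_schwarz_titu y w_gt0C)).
  rewrite ler_wpM2r ?w_le // sumr_ge0 // => i /w_gt0C wi_gt0.
  by rewrite divr_ge0 ?sqr_ge0 ?ltW.
case/forall_inPn => i; rewrite inE => yi0 /forall_inPn[j].
rewrite inE negb_imply => yj0 /andP[neq_ij nGij].
have yi_gt0 : 0 < y i by rewrite lt0r yi0 y_ge0.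
have yj_gt0 : 0 < y j by rewrite lt0r yj0 y_ge0.
pose d k : R := (k == i)%:R - (k == j)%:R.
pose L := \sum_k \sum_l (~~ G k l)%:R * (w k)^-1 * (y k * d l + d k * y l).
have q_line t : q (fun k => y k + t * d k) = q y + t * L.
  (* All four pairs formed from i and j are nonadjacent, so the coefficients of t^2 cancel. *)
  have qd0 : \sum_k \sum_l (~~ G k l)%:R * (w k)^-1 * (d k * d l) = 0.
    have sumd (F : T -> R) : \sum_k F k * d k = F i - F j.
      under eq_bigr do rewrite mulrBr.
      rewrite sumrB; congr (_ - _).
        rewrite (bigD1 i) //= eqxx mulr1 big1 ?addr0 // => k /negPf ->.
        by rewrite mulr0.
      rewrite (bigD1 j) //= eqxx mulr1 big1 ?addr0 // => k /negPf ->.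
      by rewrite mulr0.
    under eq_bigr => k _.
      under eq_bigr do rewrite mulrA.
      rewrite sumd -mulrBl; over.
    by rewrite sumd !irrG [G j i]symG nGij /= !subrr.
  transitivity (q y + t * L + t ^+ 2 *
      \sum_k \sum_l (~~ G k l)%:R * (w k)^-1 * (d k * d l)); last first.
    by rewrite qd0 mulr0 addr0.
  rewrite /q /L !mulr_sumr -!big_split; apply: eq_bigr => k _ /=.
  rewrite !mulr_sumr -!big_split; apply: eq_bigr => l _ /=.
  by ring.
have sum_line t : \sum_k (y k + t * d k) = \sum_k y k.
  rewrite big_split -mulr_sumr sumrB /= -[RHS]addr0; congr (_ + _).
  rewrite (bigD1 i) //= eqxx big1 => [|k /negPf -> //].
  rewrite [X in _ - X](bigD1 j) //= eqxx big1 => [|k /negPf -> //].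
  by rewrite subrr mulr0.
(* The induction hypothesis applies once [t] removes some [k0] from the support without enlarging
   it. *)
have step t k0 : y k0 != 0 -> (forall k, 0 <= y k + t * d k) ->
    y k0 + t * d k0 = 0 -> (forall k, y k = 0 -> d k = 0) ->
    (\sum_k y k) ^+ 2 <= lam * (q y + t * L).
  move=> yk0 ge0 k0_0 d0; rewrite -(sum_line t) -q_line; apply: IHm => //.
    apply: leq_trans card_y; apply: proper_card; apply/properP; split.
      apply/fintype.subsetP => k; rewrite !inE; apply: contraNneq => yk.
      by rewrite yk d0 // mulr0 addr0.
    by exists k0; rewrite !inE ?k0_0 ?eqxx.
  by move=> k nz; apply: w_gt0; apply: contraNneq nz => yk; rewrite yk d0 // mulr0 addr0.
have d0 k : y k = 0 -> d k = 0.
  rewrite /d => yk; case: eqP => [ki|_]; first by rewrite -ki yk eqxx in yi0.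
  by case: eqP => [kj|_]; [rewrite -kj yk eqxx in yj0 | rewrite subrr].
have neq_ji : (j == i) = false by rewrite eq_sym (negPf neq_ij).
(* t = y j moves the whole mass of j to i; in [down], t = - y i moves that of i to j. *)
have up : (\sum_k y k) ^+ 2 <= lam * (q y + y j * L).
  apply: (step _ j) => // [k|]; rewrite /d ?eqxx ?neq_ji; last by rewrite /=; ring.
  have [->|_] := eqVneq k j; first by rewrite neq_ji /=; lra.
  by rewrite subr0 addr_ge0 // mulr_ge0 ?ler0n.
have down : (\sum_k y k) ^+ 2 <= lam * (q y + - y i * L).
  apply: (step _ i) => // [k|]; rewrite /d ?eqxx ?(negPf neq_ij); last by rewrite /=; ring.
  have [->|_] := eqVneq k i; first by rewrite (negPf neq_ij) /=; lra.
  by rewrite sub0r mulrNN addr_ge0 // mulr_ge0 ?ler0n.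
(* With weights y i and y j on the two bounds, the terms in L cancel. *)
have sum_gt0 : 0 < y i + y j by rewrite addr_gt0.
rewrite -(ler_pM2l sum_gt0) -/(q y) mulrDl.
have -> : (y i + y j) * (lam * q y) =
          y i * (lam * (q y + y j * L)) + y j * (lam * (q y + - y i * L)).
  by ring.
by rewrite lerD // ler_pM2l.
Qed.

(** * Completely positive cone and cliques *)

Lemma inner_sumr (R : realType) (n : nat) (I : finType) (M : 'M[R]_n)
    (N : I -> 'M[R]_n) :
  inner M (\sum_l N l) = \sum_l inner M (N l).
Proof. by rewrite /inner mulmx_sumr raddf_sum. Qed.

Lemma sqrtv_ge0 (R : realType) (n : nat) (w : 'cV[R]_n) i : 0 <= sqrtv w i 0.
Proof. by rewrite mxE sqrtr_ge0. Qed.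

Lemma sqr_sqrtv (R : realType) (n : nat) (w : 'cV[R]_n) i :
  0 <= w i 0 -> sqrtv w i 0 ^+ 2 = w i 0.
Proof. by move=> wi_ge0; rewrite mxE sqr_sqrtr. Qed.

Lemma rank1E (R : realType) (n : nat) (x : 'cV[R]_n) i j :
  (x *m x^T) i j = x i 0 * x j 0.
Proof. by rewrite mxE big_ord1 mxE. Qed.

Lemma rank1_sym (R : realType) (n : nat) (x : 'cV[R]_n) :
  (x *m x^T)^T = x *m x^T.
Proof. by rewrite trmx_mul trmxK. Qed.

Lemma CP_rank1 (R : realType) (n : nat) (x : 'cV[R]_n) :
  (forall i, 0 <= x i 0) -> CP (x *m x^T).
Proof.
by move=> x_ge0; exists 1, (fun=> x); split => //; rewrite big_ord1.
Qed.

Lemma objective_rank1 (R : realType) (n : nat) (w x : 'cV[R]_n) :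
  objective w (x *m x^T) = (\sum_i sqrtv w i 0 * x i 0) ^+ 2.
Proof.
rewrite objectiveE expr2 mulr_suml; apply: eq_bigr => i _.
by rewrite mulr_sumr; apply: eq_bigr => j _; rewrite rank1E; ring.
Qed.

(** By linearity a single term x x^T suffices; there Motzkin-Straus is applied to y_i = sqrt(w_i)
    x_i, whose support lies where w_i > 0. *)
Lemma CP_objective_le (R : realType) (n : nat) (G : rel 'I_n) (w : 'cV[R]_n)
    (lam : R) (Z : 'M[R]_n) :
  symmetric G -> irreflexive G -> (forall i, 0 <= w i 0) ->
  (forall C : {set 'I_n}, clique G C -> \sum_(i in C) w i 0 <= lam) ->
  CP Z -> objective w Z <= lam * inner (wmx w (1%:M + compl_adj R G)) Z.
Proof.
move=> symG irrG w_ge0 w_le [k [x [x_ge0 ->]]].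
rewrite /objective !inner_sumr mulr_sumr; apply: ler_sum => l _.
rewrite -/(objective _ _) objective_rank1 inner_wmxE ?rank1_sym //.
apply: le_trans (motzkin_straus symG irrG w_le _ _) _ => [i|i|].
- by rewrite mulr_ge0 ?sqrtv_ge0.
- by rewrite mulf_eq0 negb_or mxE sqrtr_eq0 -ltNge => /andP[].
(* With a = sqrt w the two sides agree term by term: a_i^-2 a_i a_j = a_j / a_i, and both are 0 when
   a_i = 0. *)
rewrite le_eqVlt; apply/orP; left; apply/eqP; congr (_ * _); apply: eq_bigr => i _; apply: eq_bigr => j _.
rewrite rank1E -(sqr_sqrtv (w_ge0 i)).
have [->|nz] := eqVneq (sqrtv w i 0) 0; last by field.
by rewrite expr0n invr0; ring.
Qed.

Lemma clique_feasible (R : realType) (n : nat) (G : rel 'I_n) (w : 'cV[R]_n)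
    (C : {set 'I_n}) :
  symmetric G -> irreflexive G -> (forall i, 0 <= w i 0) ->
  clique G C -> 0 < \sum_(i in C) w i 0 ->
  exists Z, [/\ std_feasible G (@CP R n) Z, wgt_feasible G w (@CP R n) Z
              & objective w Z = \sum_(i in C) w i 0].
Proof.
move=> symG irrG w_ge0 clC; set T := \sum_(i in C) _ => T_gt0.
(* On C this is sqrt(w_i / T): a unit vector whose product with sqrt w is sqrt T. *)
pose x : 'cV[R]_n :=
  \col_i ((i \in C)%:R * (sqrtv w i 0 / Num.sqrt T)).
have x_ge0 i : 0 <= x i 0.
  by rewrite mxE mulr_ge0 ?ler0n // divr_ge0 ?sqrtr_ge0 ?sqrtv_ge0.
have sqT : Num.sqrt T ^+ 2 = T by rewrite sqr_sqrtr ?ltW.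
have sqT0 : Num.sqrt T != 0 by rewrite sqrtr_eq0 -ltNge.
have x_sqr i : x i 0 * x i 0 = (i \in C)%:R * (w i 0 / T).
  rewrite mxE -[in RHS]sqT -(sqr_sqrtv (w_ge0 i)).
  by case: (i \in C) => /=; field.
have trx : \sum_i x i 0 * x i 0 = 1.
  under eq_bigr do rewrite x_sqr mulrA.
  rewrite -mulr_suml -[RHS](divff (lt0r_neq0 T_gt0)) /T big_mkcond /=.
  congr (_ / _); rewrite [RHS]big_mkcond; apply: eq_bigr => i _.
  by case: ifP => _; rewrite ?mul1r ?mul0r.
have stdx : std_feasible G (@CP R n) (x *m x^T).
  split; last exact: CP_rank1.
    by rewrite /inner mul1mx -trx; apply: eq_bigr => i _; rewrite rank1E.
  apply/matrixP => i j; rewrite mxE rank1E !mxE.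
  have [iC|_] := boolP (i \in C); last by rewrite !mul0r.
  have [jC|_] := boolP (j \in C); last by rewrite mul0r mulr0 mul0r.
  have [|neq_ij] := eqVneq i j; first by rewrite mulr0.
  by rewrite (cliqueP _ _ clC) //= mulr0.
exists (x *m x^T); split => //.
  split; last exact: CP_rank1.
  rewrite (std_feasible_wmxE w symG irrG _ stdx) ?rank1_sym // -[RHS]trx.
  apply: eq_bigr => i _; rewrite rank1E.
  (* Vertices of zero weight carry no mass of [x], so the trace over the support of [w] is the whole
     trace. *)
  have [ai0|nz] := eqVneq (sqrtv w i 0) 0; last by rewrite divff ?mul1r.
  by rewrite [x i 0]mxE ai0; ring.
rewrite objective_rank1.
have -> : \sum_i sqrtv w i 0 * x i 0 = T / Num.sqrt T.
  rewrite /T mulr_suml [RHS]big_mkcond; apply: eq_bigr => i _.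
  by rewrite [x i 0]mxE -(sqr_sqrtv (w_ge0 i)); case: (i \in C) => /=; ring.
by rewrite exprMn exprVn sqT expr2 -mulrA divff ?mulr1 ?lt0r_neq0.
Qed.

(** * Moving nonadjacent entries to the diagonal *)

(* Adding z_ik (u e_i - u^-1 e_k)(u e_i - u^-1 e_k)^T with u^2 = a_k / a_i
   clears the entry (i, k) of a nonadjacent pair and does not change the value
   at [a]; summing over all such pairs gives this matrix.  Since 0^-1 = 0, it
   is restricted to the support of [a]. *)
Definition merge_nonadj (R : realType) (n : nat) (G : rel 'I_n) (a : 'cV[R]_n)
    (Z : 'M[R]_n) : 'M[R]_n :=
  \matrix_(i, j) ((i == j)%:R * \sum_k (~~ G i k)%:R * (a k 0 / a i 0) * Z i k
    + (G i j)%:R * ((a i 0 / a i 0) * Z i j * (a j 0 / a j 0))).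

(** Serves twice: at arbitrary [x] for positive semidefiniteness, and at [x = a] for the
    objective. *)
Lemma merge_nonadj_quad (R : realType) (n : nat) (G : rel 'I_n)
    (a x : 'cV[R]_n) (Z : 'M[R]_n) :
  (x^T *m merge_nonadj G a Z *m x) 0 0 =
  \sum_i \sum_j ((~~ G i j)%:R * (a j 0 / a i 0) * Z i j * x i 0 ^+ 2
    + (G i j)%:R * (x i 0 * (a i 0 / a i 0) * Z i j * (x j 0 * (a j 0 / a j 0)))).
Proof.
rewrite quadE; apply: eq_bigr => i _; rewrite big_split /= -mulr_suml.
under eq_bigr do rewrite mxE mulrDr mulrDl.
rewrite big_split /=; congr (_ + _); last by apply: eq_bigr => j _; ring.
rewrite (bigD1 i) //= eqxx [X in _ + X]big1 ?addr0 /=; first by ring.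
by move=> j /negPf neq_ji; rewrite eq_sym neq_ji mul0r mulr0 mul0r.
Qed.

(** Compared with the form of [Z] at the restriction of [x] to the support of [a], the excess is a
    sum over nonadjacent pairs of nonnegative multiples of squares. *)
Lemma merge_nonadj_DNN (R : realType) (n : nat) (G : rel 'I_n)
    (a : 'cV[R]_n) (Z : 'M[R]_n) :
  symmetric G -> (forall i, 0 <= a i 0) -> DNN Z -> DNN (merge_nonadj G a Z).
Proof.
move=> symG a_ge0 [[symZ psdZ] Z_ge0].
have ratio_ge0 i j : 0 <= a i 0 / a j 0 by rewrite divr_ge0.
have symZE i j : Z j i = Z i j by rewrite -{1}symZ mxE.
split; last first.
  move=> i j; rewrite mxE addr_ge0 //; last by rewrite !mulr_ge0 ?ler0n ?invr_ge0.
  by rewrite mulr_ge0 ?ler0n ?sumr_ge0 // => k _; rewrite !mulr_ge0 ?ler0n ?invr_ge0.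
split=> [|x].
  apply/matrixP => i j; rewrite !mxE [G j i]symG [Z j i]symZE [j == i]eq_sym.
  by have [->|_] := eqVneq i j; rewrite /= ?mul0r; ring.
rewrite merge_nonadj_quad.
pose y : 'cV[R]_n := \col_i (x i 0 * (a i 0 / a i 0)).
apply: le_trans (psdZ y) _; rewrite quadE -subr_ge0 -sumrB.
set S := \sum_i _.
pose f i j : R := (~~ G i j)%:R * Z i j *
  (a j 0 / a i 0 * x i 0 ^+ 2 - y i 0 * y j 0).
have S_f : S = \sum_i \sum_j f i j.
  apply: eq_bigr => i _; rewrite -sumrB; apply: eq_bigr => j _.
  by rewrite /f !mxE; case: (G i j) => /=; ring.
(* A single f i j may be negative; the square appears only in f i j + f j i, hence the doubling. *)
suff : 0 <= S + S by lra.
rewrite {1}S_f S_f [X in _ + X]exchange_big /= -big_split sumr_ge0 // => i _.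
rewrite -big_split sumr_ge0 //= => j _.
rewrite /f symG symZE -mulrDr mulr_ge0 ?mulr_ge0 ?ler0n //.
rewrite !mxE.
have [->|ai0] := eqVneq (a i 0) 0; first by rewrite invr0; lra.
have [->|aj0] := eqVneq (a j 0) 0; first by rewrite invr0; lra.
rewrite !divff // !mulr1.
have -> : a j 0 / a i 0 * x i 0 ^+ 2 - x i 0 * x j 0
    + (a i 0 / a j 0 * x j 0 ^+ 2 - x j 0 * x i 0) =
    a i 0 * a j 0 * (x i 0 / a i 0 - x j 0 / a j 0) ^+ 2.
  by field; rewrite ai0 aj0.
by rewrite mulr_ge0 ?sqr_ge0 ?[0 <= a i 0 * _]mulr_ge0.
Qed.

(** The trace of [merge_nonadj] is the weighted constraint in the form of [inner_wmxE], and its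
    quadratic form at sqrt w agrees with that of [Z]. *)
Lemma DNN_wgt_to_std (R : realType) (n : nat) (G : rel 'I_n) (w : 'cV[R]_n)
    (Z : 'M[R]_n) :
  symmetric G -> irreflexive G -> wgt_feasible G w (@DNN R n) Z ->
  exists2 Y, std_feasible G (@DNN R n) Y & objective w Y = objective w Z.
Proof.
move=> symG irrG [wgt1 DNNZ0]; have [[symZ _] _] := DNNZ0.
exists (merge_nonadj G (sqrtv w) Z).
  split; last exact: merge_nonadj_DNN symG (@sqrtv_ge0 _ _ w) DNNZ0.
    rewrite -[RHS]wgt1 inner_wmxE // /inner mul1mx; apply: eq_bigr => i _.
    by rewrite mxE eqxx irrG mul1r mul0r addr0.
  apply/matrixP => i j; rewrite !mxE.
  have [|_] := eqVneq i j; first by rewrite mulr0.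
  by case: (G i j) => /=; ring.
rewrite [LHS]inner_rank1 merge_nonadj_quad objectiveE.
apply: eq_bigr => i _; apply: eq_bigr => j _.
have aVa (r : R) : r * (r / r) = r.
  by have [->|nz] := eqVneq r 0; [rewrite mul0r | rewrite divff ?mulr1].
rewrite !aVa; case: (G i j) => /=; first by ring.
by rewrite -[in RHS](aVa (sqrtv w i 0)); ring.
Qed.

(** * From the standard to the weighted program *)

Lemma exists_weight_gt0 (R : realType) (n : nat) (w : 'cV[R]_n) :
  (forall i, 0 <= w i 0) -> w <> 0 -> exists i, 0 < w i 0.
Proof.
move=> w_ge0 w_neq0; apply/existsP; apply: contraPT w_neq0 => /existsPn w_le0.
apply; apply/colP => i; rewrite mxE; apply/le_anti.
by rewrite w_ge0 leNgt w_le0.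
Qed.

Lemma clique1 (T : finType) (G : rel T) i : clique G [set i].
Proof. by apply/cliqueP => j k /set1P-> /set1P->; rewrite eqxx. Qed.

(** If the trace over the support of [w] were 0, the diagonal would vanish there, by
    [psd_offdiag_le] no entry there would be positive, and the objective would be at most 0. *)
Lemma wgt_DNN_gt0 (R : realType) (n : nat) (G : rel 'I_n) (w : 'cV[R]_n)
    (Z : 'M[R]_n) :
  symmetric G -> irreflexive G -> std_feasible G (@DNN R n) Z ->
  0 < objective w Z -> 0 < inner (wmx w (1%:M + compl_adj R G)) Z.
Proof.
move=> symG irrG stdZ; have [_ _ DNNZ0] := stdZ.
have [psdZ0 Z_ge0] := DNNZ0; have [symZ _] := psdZ0.
have /andP[t_ge0 _] := std_feasible_wmx_le1 w symG irrG DNNZ0 stdZ.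
move=> obj_gt0; rewrite lt_neqAle t_ge0 andbT; apply/eqP => t0.
suff : objective w Z <= 0 by rewrite leNgt obj_gt0.
move/esym: t0; rewrite (std_feasible_wmxE w symG irrG symZ stdZ) => t0.
have diag0 i : sqrtv w i 0 != 0 -> Z i i = 0.
  move=> nz; have := @psumr_eq0P _ _ xpredT _ _ t0 i isT.
  by rewrite divff // mul1r; apply=> j _; rewrite mulr_ge0 ?divr_ge0 ?sqrtv_ge0.
rewrite objectiveE sumr_le0 // => i _; rewrite sumr_le0 // => j _.
have [->|ai0] := eqVneq (sqrtv w i 0) 0; first by rewrite !mul0r.
have [->|aj0] := eqVneq (sqrtv w j 0) 0; first by rewrite mulr0.
have := psd_offdiag_le i j psdZ0; rewrite !diag0 // addr0 pmulrn_lle0 // => Zij.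
by rewrite mulr_le0_ge0 ?mulr_ge0_le0 ?sqrtv_ge0.
Qed.

(** With t the weighted value of [Z], the matrix Z / t is feasible, and t <= 1 ensures that the
    objective does not decrease. *)
Lemma DNN_std_to_wgt (R : realType) (n : nat) (G : rel 'I_n) (w : 'cV[R]_n)
    (Z : 'M[R]_n) :
  symmetric G -> irreflexive G -> (forall i, 0 <= w i 0) -> w <> 0 ->
  std_feasible G (@DNN R n) Z ->
  exists2 Y, wgt_feasible G w (@DNN R n) Y & objective w Z <= objective w Y.
Proof.
move=> symG irrG w_ge0 w_neq0 stdZ; have [_ _ DNNZ0] := stdZ.
have [obj_le0|obj_gt0] := leP (objective w Z) 0.
  (* Here t may be 0; a single vertex of positive weight provides a feasible matrix instead. *)
  have [i wi_gt0] := exists_weight_gt0 w_ge0 w_neq0.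
  have [|Y [_ [wgt1 CPY] objY]] :=
    clique_feasible symG irrG w_ge0 (clique1 G i); first by rewrite big_set1.
  exists Y; first by split=> //; exact: CP_subset_DNN.
  by rewrite objY big_set1 (le_trans obj_le0).
have t_gt0 := wgt_DNN_gt0 symG irrG stdZ obj_gt0.
have /andP[_ t_le1] := std_feasible_wmx_le1 w symG irrG DNNZ0 stdZ.
move: t_gt0 t_le1; set t := inner _ Z => t_gt0 t_le1.
exists (t^-1 *: Z).
  split; last by apply: DNNZ => //; rewrite invr_ge0 ltW.
  by rewrite innerZr -/t mulVf ?lt0r_neq0.
by rewrite objectiveZ ler_peMl ?(ltW obj_gt0) // invf_ge1.
Qed.

(** For w = 0 the weighted constraint reads 0 = 1; the supremum of the empty set, 0 by convention,
    then matches the value of the standard program. *)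
Lemma opt_value0 (R : realType) (n : nat) (F : set 'M[R]_n) :
  opt_value 0 F = 0.
Proof.
have obj0 Z : objective 0 Z = 0 :> R.
  rewrite objectiveE big1 // => i _; rewrite big1 // => j _.
  by rewrite !mxE sqrtr0 !mul0r.
have [[Z FZ]|noF] := pselect (exists Z, F Z).
  by rewrite (attained_opt_value FZ) ?obj0 // => Y _; rewrite !obj0.
suff -> : F = set0%classic by rewrite /opt_value image_set0 sup0.
by rewrite -subset0 => Z FZ; case: noF; exists Z.
Qed.

(** * Compactness and attainment *)

Local Open Scope classical_set_scope.

Lemma sum_continuous (R : realType) (T : topologicalType) (I : finType)
    (F : I -> T -> R) :
  (forall i, continuous (F i)) -> continuous (fun x => \sum_i F i x).
Proof.
move=> cF; have cadd : continuous (fun p : R * R => p.1 + p.2).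
  by move=> p; exact: add_continuous.
by have := @continuous_big R I +%R 0 xpredT cadd T (index_enum I) F; exact.
Qed.

(** Matrices are flattened to row vectors, the setting of [rV_compact] and [EVT_max_rV]. *)
Lemma inner_continuous (R : realType) (n : nat) (C : 'M[R]_n) :
  continuous (fun v : 'rV[R]_(n * n) => inner C (vec_mx v)).
Proof.
have -> : (fun v : 'rV[R]_(n * n) => inner C (vec_mx v)) =
    (fun v => \sum_i \sum_j C i j * v 0 (mxvec_index j i)).
  apply: funext => v; rewrite innerE; apply: eq_bigr => i _.
  by apply: eq_bigr => j _; rewrite mxE.
apply: (@sum_continuous R ('rV[R]_(n * n))) => i.
apply: (@sum_continuous R ('rV[R]_(n * n))) => j v.
by apply: continuousM; [exact: cst_continuous | exact: coord_continuous].
Qed.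

(** A closed part of the unit cube is compact, so the extreme value theorem applies. *)
Lemma compact_attained (R : realType) (n : nat) (w : 'cV[R]_n)
    (F : set 'M[R]_n) :
  (exists Z, F Z) -> (forall Z, F Z -> forall i j, 0 <= Z i j <= 1) ->
  closed [set v : 'rV[R]_(n * n) | F (vec_mx v)] -> attained w F.
Proof.
move=> [Z0 FZ0] F01 Fclosed.
set V := [set v : 'rV[R]_(n * n) | F (vec_mx v)] in Fclosed *.
have V0 : V !=set0 by exists (mxvec Z0); rewrite /V /= mxvecK.
have Vcompact : compact V.
  have boxc := @rV_compact _ (n * n) (fun=> `[0, 1]%classic : set R)
    (fun=> @segment_compact R 0 1).
  apply: subclosed_compact Fclosed boxc _ => v Fv k /=.
  case/mxvec_indexP: k => i j; have := F01 _ Fv i j.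
  by rewrite mxE in_itv.
have cont : {within V, continuous (fun v => objective w (vec_mx v))}.
  exact/continuous_subspaceT/inner_continuous.
have [v Vv maxv] := EVT_max_rV V0 Vcompact cont.
exists (vec_mx v); first by rewrite inE in Vv.
move=> Y FY; rewrite -(mxvecK Y); apply: maxv.
by rewrite inE /V /= mxvecK.
Qed.

(** Each condition is a preimage of a closed subset of R under some [inner C]; positive
    semidefiniteness is an intersection over all test vectors. *)
Lemma std_DNN_closed (R : realType) (n : nat) (G : rel 'I_n) :
  closed [set v : 'rV[R]_(n * n) | std_feasible G (@DNN R n) (vec_mx v)].
Proof.
have innerM (C : 'M[R]_n) (A : set R) : closed A ->
    closed [set v : 'rV[R]_(n * n) | A (inner C (vec_mx v))].
  by move/continuous_closedP: (@inner_continuous R n C); exact.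
(* The indices are transposed because [inner] is tr(MN). *)
have entry (M : 'M[R]_n) i j : inner (delta_mx j i) M = M i j.
  rewrite innerE (bigD1 j) //= (bigD1 i) //= mxE !eqxx mul1r.
  rewrite !big1 ?addr0 // => [k /negPf kj|k /negPf ki]; last first.
    by rewrite mxE ki andbF mul0r.
  by rewrite big1 // => l _; rewrite mxE kj mul0r.
have -> : [set v : 'rV[R]_(n * n) | std_feasible G (@DNN R n) (vec_mx v)] =
  [set v | inner 1%:M (vec_mx v) = 1]
  `&` ((\bigcap_(p in [set p : 'I_n * 'I_n | (p.1 != p.2) && ~~ G p.1 p.2])
       [set v | inner (delta_mx p.2 p.1) (vec_mx v) = 0])
  `&` ((\bigcap_(p in [set: 'I_n * 'I_n])
         [set v | inner (delta_mx p.2 p.1 - delta_mx p.1 p.2) (vec_mx v) = 0])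
  `&` ((\bigcap_(x in [set: 'cV[R]_n])
         [set v | 0 <= inner (x *m x^T) (vec_mx v)])
  `&` (\bigcap_(p in [set: 'I_n * 'I_n])
       [set v | 0 <= inner (delta_mx p.2 p.1) (vec_mx v)])))).
  have innerB (A B M : 'M[R]_n) : inner (A - B) M = inner A M - inner B M.
    by rewrite /inner mulmxBl linearB.
  apply/seteqP; split=> v /=.
    move=> stdv; have [tr1 _ [[sym Z_ge0] Z_nneg]] := stdv; split=> //; split.
      by move=> [i j] /= /andP[? ?]; rewrite entry (std_feasible_offdiag stdv).
    split; last split.
    - by move=> [i j] _ /=; rewrite innerB !entry -{1}sym mxE subrr.
    - by move=> x _ /=; rewrite inner_rank1.
    - by move=> [i j] _ /=; rewrite entry.
  move=> [tr1 [off [sym [Z_ge0 Z_nneg]]]]; split=> //.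
    apply/matrixP => i j; rewrite !mxE.
    have [/(off (i, j))|_] := boolP ((i != j) && ~~ G i j); last by rewrite mulr0.
    by rewrite /= entry mxE => ->; rewrite mul0r.
  split; first split.
  - apply/matrixP => i j; rewrite mxE; apply/eqP; rewrite -subr_eq0; apply/eqP.
    by have := sym (j, i) I; rewrite /= innerB !entry.
  - by move=> x; rewrite -inner_rank1; exact: Z_ge0.
  - by move=> i j; have := Z_nneg (i, j) I; rewrite /= entry.
have c1 : closed [set r : R | r = 1] by exact: closed_eq.
have c0 : closed [set r : R | r = 0] by exact: closed_eq.
have cge0 : closed [set r : R | 0 <= r] by exact: closed_ge.
apply: closedI; first exact: innerM c1.
apply: closedI; first by apply: closed_bigI => p _; exact: innerM c0.
apply: closedI; first by apply: closed_bigI => p _; exact: innerM c0.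
apply: closedI; first by apply: closed_bigI => x _; exact: innerM cge0.
by apply: closed_bigI => p _; exact: innerM cge0.
Qed.

(** Entries lie in [0, 1]: diagonal ones are bounded by the trace, the others by the mean of two
    diagonal ones. *)
Lemma std_DNN_attained (R : realType) (n : nat) (G : rel 'I_n) (w : 'cV[R]_n) :
  (exists Z, std_feasible G (@DNN R n) Z) ->
  attained w (std_feasible G (@DNN R n)).
Proof.
move=> ex_std; apply: compact_attained => // [Z stdZ i j|]; last first.
  exact: std_DNN_closed.
have [_ _ [psdZ0 Z_ge0]] := stdZ; rewrite Z_ge0 /=.
have diag_le1 k : Z k k <= 1.
  by rewrite -(std_feasible_trace stdZ) (bigD1 k) //= lerDl sumr_ge0.
have := psd_offdiag_le i j psdZ0; have := diag_le1 i; have := diag_le1 j.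
by rewrite mulr2n; lra.
Qed.

Theorem theorem29 (R : realType) (n : nat) (G : rel 'I_n)
    (symG : symmetric G) (irrG : irreflexive G)
    (w : 'cV[R]_n) (w_ge0 : forall i, 0 <= w i 0) :
  [/\ opt_value w (wgt_feasible G w (@DNN R n)) = chi_vec G w,
      opt_value w (wgt_feasible G w (@CP R n)) = omega G w
    & w <> 0 -> attained w (wgt_feasible G w (@DNN R n))
                /\ attained w (wgt_feasible G w (@CP R n))].
Proof.
have [->|/eqP w_neq0] := eqVneq w 0.
  by split; rewrite /chi_vec /omega ?opt_value0 // => /(_ erefl).
have [i0 wi0_gt0] := exists_weight_gt0 w_ge0 w_neq0.
pose wt (C : {set 'I_n}) := \sum_(i in C) w i 0.
case: (@Order.TotalTheory.arg_maxP _ _ _ [set i0]%SET (clique G) wt (clique1 G i0)).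
(* C is a heaviest clique; comparison with the singleton of i0 makes its weight positive. *)
move=> C clC maxC.
have wt_gt0 : 0 < wt C.
  by apply: lt_le_trans (maxC _ (clique1 G i0)); rewrite /wt big_set1.
have [Zc [stdZc wgtZc objZc]] := clique_feasible symG irrG w_ge0 clC wt_gt0.
have obj_le Z : CP Z -> objective w Z <=
    objective w Zc * inner (wmx w (1%:M + compl_adj R G)) Z.
  by rewrite objZc; exact: CP_objective_le.
have max_wgt Z : wgt_feasible G w (@CP R n) Z -> objective w Z <= objective w Zc.
  by move=> [wgt1 CPZ]; rewrite (le_trans (obj_le Z CPZ)) // wgt1 mulr1.
(* In the standard program the weighted value is at most 1, so the same bound works. *)
have max_std Z : std_feasible G (@CP R n) Z -> objective w Z <= objective w Zc.
  move=> stdZ; have [_ _ CPZ] := stdZ; apply: le_trans (obj_le Z CPZ) _.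
  have /andP[_ t_le1] :=
    std_feasible_wmx_le1 w symG irrG (CP_subset_DNN CPZ) stdZ.
  by rewrite ler_piMr // objZc ltW.
have [|Z stdZ maxZ] := @std_DNN_attained R n G w.
  by have [tr1 off CPZc] := stdZc; exists Zc; split=> //; exact: CP_subset_DNN.
(* Z is optimal in the standard program; transfer in both directions makes Y optimal in the weighted
   one, with the same value. *)
have [Y wgtY leZY] := DNN_std_to_wgt symG irrG w_ge0 w_neq0 stdZ.
have wgt_le X : wgt_feasible G w (@DNN R n) X -> objective w X <= objective w Z.
  by case/(DNN_wgt_to_std symG irrG) => X' stdX' <-; exact: maxZ.
have maxY X : wgt_feasible G w (@DNN R n) X -> objective w X <= objective w Y.
  by move/wgt_le => leXZ; exact: le_trans leXZ leZY.
split; last by move=> _; split; [exists Y | exists Zc].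
  rewrite /chi_vec (attained_opt_value wgtY maxY) (attained_opt_value stdZ maxZ).
  by apply/le_anti; rewrite leZY wgt_le.
by rewrite /omega (attained_opt_value wgtZc max_wgt) (attained_opt_value stdZc max_std).
Qed.
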